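(* For any integers $r\ge 2$ and $t\ge 2$ there exists a function $h(n)=h(n,r,t)$ of subquadratic growth rate, $h(n)=o(n^2)$ as $n\to\infty$, with the following property. In every edge coloring $\psi$ of $K_n$ with more than $\mathrm{ex}(n,K_r)+h(n)$ colors, there occurs a complete $r$-partite subgraph $K\cong K_{t,\dots,t}$, say with vertex classes $V_1,\dots,V_r$ (each of size $t$), such that (i) $K$ is rainbow-colored (all edges of $K$ have mutually distinct colors); (ii) for $i=1,\dots,r$, each $V_i$ induces a $K_t$ which is either monochromatic or rainbow or LEX-colored; (iii) no color of $K$ is repeated inside any $V_i$, that is, no edge of $K_n$ with both ends in the same $V_i$ has a color that occurs on an edge of $K$.
   Context: $\mathrm{ex}(n,F)$ is the Turán number: the maximum number of edges in a graph of order $n$ that contains no subgraph isomorphic to $F$ (in particular $\mathrm{ex}(n,K_2)=0$). Edge colorings are arbitrary, not necessarily proper; the number of colors is the number of colors actually used. A complete graph is rainbow if all its edges have distinct colors, monochromatic if all its edges have the same color, and LEX-colored if its vertices can be ordered as $v_1,v_2,\dots,v_t$ so that the color of each edge $v_iv_j$ with $1\le i<j\le t$ is $c_{j-1}$, where $c_1,\dots,c_{t-1}$ are mutually distinct colors. *)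

(* Defs.v *)
From mathcomp Require Import all_boot.

Set Implicit Arguments.
Unset Strict Implicit.
Unset Printing Implicit Defensive.

(* A simple graph on the finite vertex type T is represented by its edge set
   G : {set {set T}}, all of whose members are 2-element sets of vertices. *)
Definition complete_graph (T : finType) : {set {set T}} :=
  [set e : {set T} | #|e| == 2].

Definition simple_graph (T : finType) (G : {set {set T}}) : bool :=
  G \subset complete_graph T.

Definition has_copy (S T : finType) (F : {set {set S}}) (G : {set {set T}}) :
    bool :=
  [exists f : {ffun S -> T},
     injectiveb f && [forall e in F, f @: e \in G]].

(* When F has at least one edge, the edgeless graph is F-free, so the maximum
   is taken over a nonempty family. *)
Definition turan_number (n : nat) (S : finType) (F : {set {set S}}) : nat :=
  \max_(G : {set {set 'I_n}} | simple_graph G && ~~ has_copy F G) #|G|.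

Definition edges_within (T : finType) (A : {set T}) : {set {set T}} :=
  [set e in complete_graph T | e \subset A].

Definition partite_classes (T : finType) (r t : nat) (V : 'I_r -> {set T}) :
    Prop :=
  (forall i, #|V i| = t) /\ (forall i j, i != j -> [disjoint V i & V j]).

(* Edges of the complete r-partite graph with vertex classes V i;
   meant for V with partite_classes t V. *)
Definition edges_across (T : finType) (r : nat) (V : 'I_r -> {set T}) :
    {set {set T}} :=
  [set e in complete_graph T |
    [exists i, exists j, (i != j) &&
      [exists x in V i, exists y in V j, e == [set x; y]]]].

(* An edge coloring of the complete graph on T is a map psi : {set T} -> C, of
   which only the values on 2-element sets matter. *)
Section Colorings.
Variables (T : finType) (C : eqType) (psi : {set T} -> C).

Definition num_colors : nat :=
  size (undup [seq psi e | e in complete_graph T]).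

Definition rainbow (E : {set {set T}}) : Prop := {in E &, injective psi}.

Definition monochromatic (E : {set {set T}}) : Prop :=
  {in E &, forall e f, psi e = psi f}.

(* The vertices are numbered from 0, so the colors used are c 1, ..., c t.-1. *)
Definition lex_colored (A : {set T}) : Prop :=
  exists (v : 'I_#|A| -> T) (c : nat -> C),
    [/\ injective v,
        v @: 'I_#|A| = A,
        {in [pred k | 0 < k < #|A|] &, injective c}
      & forall i j : 'I_#|A|, i < j -> psi [set v i; v j] = c j].

End Colorings.

(* Main.v *)
Require Import Defs.
From mathcomp Require Import all_boot all_order all_algebra.
From mathcomp Require Import all_classical all_reals all_analysis.
(* Last, so that names such as subsetP refer to finite sets. *)
From mathcomp Require Import fintype finset zify ring.
Import Order.TTheory GRing.Theory Num.Theory.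
Import numFieldNormedType.Exports.

(** Pick one edge of every color: this gives a rainbow graph G with as many
    edges as there are colors.  If G has at least ex(n, K_r) + n^2/q edges and n
    is large, then the Erdos-Stone theorem [blowup_of_dense] provides a complete
    r-partite subgraph of G with huge classes, automatically rainbow.  It
    remains to shrink the classes.

    Condition (iii) comes first.  Cut every class into many blocks of a fixed
    size.  The number of pairs inside a block is bounded, and each of them
    shares its color with at most one edge between the classes, because those
    are rainbow; so if the number of blocks is large compared with their size,
    a union bound lets one choose one block per class without any such
    coincidence ([clean_blocks]).  Then the canonical Ramsey theorem of Erdos
    and Rado for pairs ([canonical_ramsey]), applied inside each selected block,
    gives (ii), and both (i) and (iii) pass to subsets.

    The Erdos-Stone theorem is obtained by supersaturation, without any explicit
    value of the Turan numbers.  Let m almost minimise ex(m, K_r)/m^2 among all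
    large m.  Averaging over the maps f : [m] -> [n] shows that a positive
    proportion of them pull G back to a graph on [m] with more than ex(m, K_r)
    edges.  By pigeonhole a single graph F on [m] arises from a positive
    proportion of the f, and Erdos's theorem on dense m-ary relations
    ([dense_product]) gives large sets V_1, ..., V_m such that all transversals
    pull G back to F.  As F contains K_r, so the V_i indexed by the vertices of
    that K_r span a blow-up of K_r in G.

    The canonical Ramsey theorem is proved by a dichotomy: either one can
    repeatedly pass to the neighbourhood of a vertex in a popular color, and the
    resulting sequence of vertices contains a monochromatic or a LEX-colored
    subsequence, or one gets stuck in a large set where every color has small
    degree at every vertex, and there a union bound yields a rainbow subset.

    Finally h(n) is the excess over ex(n, K_r) of the largest number of colors
    of a coloring without the desired subgraph; the above says h(n) <= n^2/q for
    every q and all large n. *)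

(** * Resampling one coordinate, and union bounds *)

Definition update {I T : finType} (f : {ffun I -> T}) (b : I) (x : T) : {ffun I -> T} :=
  [ffun i => if i == b then x else f i].

(** Replacing a coordinate by a random value does not change the average of F:
    recording the old value makes the replacement an involution. *)
Lemma sum_update {I T : finType} (b : I) (F : {ffun I -> T} -> nat) :
  \sum_f \sum_x F (update f b x) = #|T| * \sum_f F f.
Proof.
rewrite pair_big /=.
pose h (p : {ffun I -> T} * T) := (update p.1 b p.2, p.1 b).
have hK : involutive h.
  move=> [f x]; rewrite /h /= ffunE eqxx; congr pair.
  by apply/ffunP=> i; rewrite !ffunE; case: eqP => // ->.
rewrite (reindex_inj (inv_inj hK)) /=.
rewrite (eq_bigr (fun p => F p.1)); last first.
  by move=> p _; exact: (congr1 (fun z => F z.1) (hK p)).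
rewrite -(pair_big xpredT xpredT (fun f _ => F f)) /= big_distrr /=.
by apply: eq_bigr => f _; rewrite sum_nat_const.
Qed.

Lemma card_set_sum {T : finType} (P : pred T) : #|[set x | P x]| = \sum_x P x.
Proof.
rewrite cardsE -sum1_card big_mkcond; apply: eq_bigr => x _.
by rewrite unfold_in; case: (P x).
Qed.

(** If, whatever the other coordinates are, at most d values of the coordinate b
    are bad, then at most a proportion d / #|T| of all functions is bad. *)
Lemma card_coord_le {I T : finType} (b : I) (P : pred {ffun I -> T}) (d : nat) :
  (forall f, #|[set x | P (update f b x)]| <= d) ->
  #|T| * #|[set f | P f]| <= d * #|T| ^ #|I|.
Proof.
move=> hd; rewrite card_set_sum -(sum_update b) mulnC -card_ffun -sum_nat_const.
by apply: leq_sum => f _; rewrite -card_set_sum.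
Qed.

(** A union bound.  Each bad event k is controlled
    through a single coordinate b k, so nothing has to be known about how the
    event depends on the other coordinates. *)
Lemma avoid_bad_events {I T K : finType} (b : K -> I) (P : K -> pred {ffun I -> T}) (d : nat) :
  #|K| * d < #|T| ->
  (forall k f, #|[set x | P k (update f (b k) x)]| <= d) ->
  exists f, forall k, ~~ P k f.
Proof.
move=> ltK hd; case: (boolP [exists f, [forall k, ~~ P k f]]).
  by case/existsP=> f /forallP ?; exists f.
rewrite negb_exists => /forallP bad; exfalso.
have cov : #|T| ^ #|I| <= \sum_k #|[set f | P k f]|.
  rewrite -card_ffun -sum1_card.
  rewrite (eq_bigr (fun k => \sum_f (P k f : nat))); last by move=> k _; rewrite card_set_sum.
  rewrite exchange_big /=; apply: leq_sum => f _.
  have /forallPn[k /negPn Pk] := bad f.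
  by rewrite (bigD1 k) //= Pk.
have := leq_mul (leqnn #|T|) cov; rewrite big_distrr /=.
have le2 : \sum_k #|T| * #|[set f | P k f]| <= #|K| * (d * #|T| ^ #|I|).
  rewrite -sum_nat_const; apply: leq_sum => k _; exact: card_coord_le (hd k).
move/leq_trans/(_ le2); rewrite mulnA leq_mul2r leqNgt ltK orbF expn_eq0.
by case: #|T| ltK.
Qed.

Lemma subset_of_card {T : finType} (A : {set T}) (k : nat) :
  k <= #|A| -> exists2 B : {set T}, B \subset A & #|B| = k.
Proof.
move=> le; exists [set x in take k (enum A)].
  by apply/subsetP=> x; rewrite inE => /mem_take; rewrite mem_enum.
rewrite cardsE (card_uniqP _) ?take_uniq ?enum_uniq // size_take -cardE.
by case: ltngtP le.
Qed.

Lemma pigeonhole {T S : finType} (A : {set T}) (P : {set S}) (f : T -> S) :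
  P != set0 -> {in A, forall x, f x \in P} ->
  exists2 p, p \in P & #|A| <= #|P| * #|[set x in A | f x == p]|.
Proof.
move=> /set0Pn[p0 Pp0] fP.
pose F p := #|[set x in A | f x == p]|.
have [p Pp hp] : exists2 p, p \in P & forall q, q \in P -> F q <= F p.
  by exists [arg max_(p > p0 in P) F p]; case: arg_maxnP.
exists p => //.
rewrite -sum1_card (partition_big f (mem P)) //= -sum_nat_const.
apply: leq_sum => q Pq; apply: leq_trans (hp q Pq).
by rewrite sum1_card /F cardsE.
Qed.

(** * Dense relations contain large products *)

Definition ffcons {m} {T : finType} (x : T) (y : {ffun 'I_m -> T}) : {ffun 'I_m.+1 -> T} :=
  [ffun i => if unlift ord0 i is Some j then y j else x].
Definition ffbehead {m} {T : finType} (f : {ffun 'I_m.+1 -> T}) : {ffun 'I_m -> T} :=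
  [ffun i => f (lift ord0 i)].

Lemma ffcons_head {m} {T : finType} (f : {ffun 'I_m.+1 -> T}) :
  ffcons (f ord0) (ffbehead f) = f.
Proof.
by apply/ffunP=> i; rewrite ffunE; case: unliftP => [j ->|->] //; rewrite ffunE.
Qed.

Lemma sum_ffcons {m} {T : finType} (F : {ffun 'I_m.+1 -> T} -> nat) :
  \sum_f F f = \sum_x \sum_y F (ffcons x y).
Proof.
rewrite pair_big /=.
rewrite (reindex (fun p => ffcons p.1 p.2)) //=.
exists (fun f : {ffun 'I_m.+1 -> T} => (f ord0, ffbehead f)) => [[x y] _|f _] /=.
  rewrite ffunE unlift_none; congr pair.
  by apply/ffunP=> i; rewrite !ffunE liftK.
exact: ffcons_head.
Qed.

(** Read backwards, this is the averaging argument: a function with a large sum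
    and values at most M must reach the threshold s at many points. *)
Lemma sum_threshold {T : finType} (F : T -> nat) (M s : nat) :
  (forall x, F x <= M) -> \sum_x F x <= M * #|[set x | s <= F x]| + s * #|T|.
Proof.
move=> hM; rewrite card_set_sum big_distrr /= [s * _]mulnC -sum_nat_const -big_split /=.
apply: leq_sum => x _; case: (leqP s (F x)) => h; last by rewrite muln0 ltnW.
by rewrite /= muln1 (leq_trans (hM x)) ?leq_addr.
Qed.

(** Erdos's theorem on dense m-partite hypergraphs.  By averaging, a bounded number M of first coordinates x each
    have a positive proportion of extensions y; many y are then compatible with
    at least s of these M values, and as there are only 2 ^ M subsets of values,
    many y have the same set B of compatible values.  Induct on these y. *)
Lemma dense_product (m s Q : nat) : 0 < s ->
  exists N, forall (T : finType) (H : {set {ffun 'I_m -> T}}),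
  N <= #|T| -> #|T| ^ m <= Q * #|H| ->
  exists V : 'I_m -> {set T}, (forall i, #|V i| = s) /\
    forall f : {ffun 'I_m -> T}, (forall i, f i \in V i) -> f \in H.
Proof.
move=> spos; elim: m Q => [|m IH] Q.
  exists 0 => T H _; rewrite expn0 => Hpos.
  have /card_gt0P[f0 f0H] : 0 < #|H| by move: Hpos; rewrite muln_gt0 => /andP[].
  exists (fun _ => set0); split=> [[]//|f _].
  by rewrite (_ : f = f0) //; apply/ffunP=> -[].
(* x is popular when it has at least n ^ m / (2 * Q) extensions; M popular x
   meet an average y at least M / (2 * Q) = 2 * s times. *)
pose M := 4 * Q * s.
have [N' hN'] := IH (M * 2 ^ M).
exists (maxn (maxn N' (2 * Q * M)) 1) => T H.
rewrite !geq_max => /andP[/andP[leN' leM] Tpos] dH.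
set n := #|T| in leN' leM Tpos dH *.
have npos k : 0 < n ^ k by rewrite expn_gt0 Tpos.
have Qpos : 0 < Q by have := leq_trans (npos m.+1) dH; case: (Q).
pose D x := #|[set y | ffcons x y \in H]|.
have cH : #|H| = \sum_x D x.
  have -> : H = [set f | f \in H] by apply/setP=> f; rewrite inE.
  rewrite card_set_sum sum_ffcons; apply: eq_bigr => x _.
  by rewrite /D card_set_sum; apply: eq_bigr => y _.
pose X := [set x | n ^ m <= 2 * Q * D x].
have leX : M <= #|X|.
  have : \sum_x 2 * Q * D x <= (2 * Q * n ^ m) * #|X| + n ^ m * n.
    apply: sum_threshold => x; rewrite leq_mul2l; apply/orP; right.
    by rewrite (leq_trans (max_card _)) // card_ffun card_ord.
  rewrite -big_distrr /= -cH => h.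
  have : n ^ m * n <= n ^ m * (2 * Q * #|X|) by move: dH; rewrite expnS; nia.
  rewrite leq_pmul2l // => /(leq_trans leM).
  by rewrite leq_pmul2l // muln_gt0.
have [A AX cA] := subset_of_card X M leX.
pose Hy y := [set x in A | ffcons x y \in H].
pose Y := [set y : {ffun 'I_m -> T} | s <= #|Hy y|].
have leY : n ^ m <= M * #|Y|.
  have sumE : \sum_y #|Hy y| = \sum_(x in A) D x.
    rewrite (eq_bigr (fun y => \sum_(x in A) (ffcons x y \in H : nat))); last first.
      move=> y _; rewrite /Hy -sum1_card big_mkcond /= [RHS]big_mkcond /=.
      by apply: eq_bigr => x _; rewrite inE; case: (x \in A); case: (_ \in H).
    rewrite exchange_big /=; apply: eq_bigr => x _.
    by rewrite /D card_set_sum.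
  have low : M * n ^ m <= 2 * Q * \sum_(x in A) D x.
    rewrite -cA -sum_nat_const big_distrr /=; apply: leq_sum => x xA.
    by have := subsetP AX x xA; rewrite inE.
  have up : \sum_y #|Hy y| <= M * #|Y| + s * n ^ m.
    have := @sum_threshold _ (fun y => #|Hy y|) M s; rewrite card_ffun card_ord; apply.
    by move=> y; rewrite -cA subset_leq_card //; apply/subsetP=> x; rewrite inE => /andP[].
  have : 2 * s * n ^ m <= \sum_(x in A) D x.
    rewrite -(@leq_pmul2l (2 * Q)) ?muln_gt0 //.
    by apply: leq_trans low; rewrite /M; apply: eq_leq; nia.
  rewrite -sumE; move: up; nia.
have PA : powerset A != set0 by apply/set0Pn; exists set0; rewrite inE sub0set.
have HyA : {in Y, forall y, Hy y \in powerset A}.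
  by move=> y _; rewrite inE; apply/subsetP=> x; rewrite inE => /andP[].
have [B _] := pigeonhole Y (powerset A) Hy PA HyA.
rewrite card_powerset cA; set H' := [set _ in Y | _] => leH'.
have dH' : n ^ m <= M * 2 ^ M * #|H'|.
  by rewrite -mulnA (leq_trans leY) // leq_mul2l leH' orbT.
have [y0 y0H'] : exists y0, y0 \in H'.
  by apply/card_gt0P; have := leq_trans (npos m) dH'; rewrite muln_gt0 => /andP[].
have sB : s <= #|B|.
  by move: y0H'; rewrite !inE => /andP[h /eqP <-].
have [V0 V0B cV0] := subset_of_card B s sB.
have [V [cV hV]] := hN' T H' leN' dH'.
exists (fun i => if unlift ord0 i is Some j then V j else V0); split.
  by move=> i; case: unliftP.
move=> f hf; rewrite -(ffcons_head f).
have f0 : f ord0 \in V0 by have := hf ord0; rewrite unlift_none.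
have : ffbehead f \in H'.
  by apply: hV => i; rewrite ffunE; have := hf (lift ord0 i); rewrite liftK.
rewrite !inE => /andP[_ /eqP HB].
by have := subsetP V0B _ f0; rewrite -HB inE => /andP[].
Qed.

(** * Pulling a graph back along a map *)

Lemma set2_eq {T : finType} (a b x y : T) : [set a; b] = [set x; y] ->
  (a = x /\ b = y) \/ (a = y /\ b = x).
Proof.
move=> h.
have : a \in [set x; y] by rewrite -h set21.
have : b \in [set x; y] by rewrite -h set22.
have : x \in [set a; b] by rewrite h set21.
have : y \in [set a; b] by rewrite h set22.
rewrite !inE => hy hx /orP[] /eqP bE /orP[] /eqP aE; subst; auto.
  by move: hy; rewrite orbb => /eqP ->; auto.
by move: hx; rewrite orbb => /eqP ->; auto.
Qed.

Lemma sum_pairs_edges {T : finType} (G : {set {set T}}) : simple_graph G ->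
  \sum_x \sum_y ([set x; y] \in G) = 2 * #|G|.
Proof.
move=> sG; rewrite pair_big /=.
transitivity (\sum_(p : T * T | [set p.1; p.2] \in G) 1).
  by rewrite [RHS]big_mkcond; apply: eq_bigr => p _; case: (_ \in G).
rewrite (partition_big (fun p : T * T => [set p.1; p.2]) (mem G)) //=.
rewrite mulnC -sum_nat_const; apply: eq_bigr => e eG.
have := subsetP sG e eG; rewrite inE => /cards2P[x [y [xy eE]]].
rewrite sum1_card -(_ : #|[set (x, y); (y, x)]| = 2); last first.
  by rewrite cards2; case: eqP => // -[exy _]; rewrite exy eqxx in xy.
apply: eq_card => -[u v]; rewrite !inE /= unfold_in /=.
apply/andP/orP; rewrite !xpair_eqE.
  by move=> [_ /eqP]; rewrite eE => /set2_eq[] [-> ->]; rewrite !eqxx; auto.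
by move=> [] /andP[/eqP-> /eqP->]; rewrite ?[[set y; x]]setUC -eE eG eqxx.
Qed.

Lemma card_edges_le {T : finType} (G : {set {set T}}) : simple_graph G ->
  2 * #|G| <= #|T| ^ 2.
Proof.
move=> sG; rewrite -sum_pairs_edges // -mulnn -sum_nat_const; apply: leq_sum => x _.
by rewrite -sum1_card; apply: leq_sum => y _; apply: leq_b1.
Qed.

Lemma loop_notin {T : finType} (G : {set {set T}}) (x : T) : simple_graph G ->
  ([set x; x] \in G) = false.
Proof.
by move=> sG; apply/negP=> /(subsetP sG); rewrite inE setUid cards1.
Qed.

(** Vertices identified by f are non-adjacent in the pullback, which is therefore
    a simple graph for every f; so one can average over all functions, whose
    coordinates are independent. *)
Definition pullback {I T : finType} (G : {set {set T}}) (f : {ffun I -> T}) : {set {set I}} :=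
  [set e in complete_graph I | f @: e \in G].

Lemma pullback_simple {I T : finType} (G : {set {set T}}) (f : {ffun I -> T}) :
  simple_graph (pullback G f).
Proof. by apply/subsetP=> e; rewrite inE => /andP[]. Qed.

Lemma mem_pullback {I T : finType} (G : {set {set T}}) (f : {ffun I -> T}) (a b : I) :
  simple_graph G -> ([set a; b] \in pullback G f) = ([set f a; f b] \in G).
Proof.
move=> sG; rewrite !inE imsetU1 imset_set1 cards2.
by case: (eqVneq a b) => [->|//]; rewrite loop_notin.
Qed.

(** Two distinct coordinates of a random function are independent and uniform. *)
Lemma sum_two_coords {I T : finType} (a b : I) (g : T -> T -> nat) : a != b ->
  #|T| ^ 2 * (\sum_(f : {ffun I -> T}) g (f a) (f b)) =
  #|T| ^ #|I| * \sum_x \sum_y g x y.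
Proof.
move=> ab; rewrite -mulnn -mulnA -(sum_update b) -(sum_update a) -card_ffun -sum_nat_const.
apply: eq_bigr => f _; apply: eq_bigr => x _; apply: eq_bigr => y _.
by rewrite !ffunE !eqxx (negbTE ab).
Qed.

(** In expectation, the pullback to I has the edge density of G, where loops
    count as non-edges. *)
Lemma sum_pullback {I T : finType} (G : {set {set T}}) : simple_graph G ->
  #|T| ^ 2 * (\sum_(f : {ffun I -> T}) #|pullback G f|) =
  #|I| * #|I|.-1 * #|G| * #|T| ^ #|I|.
Proof.
move=> sG; apply/eqP; rewrite -(eqn_pmul2l (isT : 0 < 2)); apply/eqP.
rewrite mulnCA big_distrr /=.
rewrite (eq_bigr (fun f : {ffun I -> T} => \sum_a \sum_b ([set f a; f b] \in G : nat))); last first.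
  move=> f _; rewrite -sum_pairs_edges ?pullback_simple //.
  by apply: eq_bigr => a _; apply: eq_bigr => b _; rewrite mem_pullback.
rewrite exchange_big big_distrr /=.
rewrite (eq_bigr (fun=> #|I|.-1 * (#|T| ^ #|I| * (2 * #|G|)))); last first.
  move=> a _; rewrite exchange_big big_distrr /= (bigD1 a) //=.
  rewrite [X in _ * X + _]big1 ?muln0 ?add0n; last by move=> f _; rewrite loop_notin.
  rewrite (eq_bigr (fun=> #|T| ^ #|I| * (2 * #|G|))); last first.
    move=> b ba; rewrite (@sum_two_coords _ _ a b (fun x y => ([set x; y] \in G))) 1?eq_sym //.
    by rewrite sum_pairs_edges.
  rewrite sum_nat_const; congr (_ * _).
  by rewrite cardC1.
rewrite sum_nat_const; ring.
Qed.

(** * The Erdos-Stone theorem *)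

Lemma gt_turan_copy (n : nat) (S : finType) (F : {set {set S}}) (G : {set {set 'I_n}}) :
  simple_graph G -> turan_number n F < #|G| -> has_copy F G.
Proof.
move=> sG lt; apply: contraLR lt => nF; rewrite -leqNgt.
by apply: (@leq_bigmax_cond _ _ (fun G : {set {set 'I_n}} => #|G|)); rewrite sG.
Qed.

Lemma turan_le (n : nat) (S : finType) (F : {set {set S}}) : 2 * turan_number n F <= n ^ 2.
Proof.
apply: (@big_ind _ (fun k => 2 * k <= n ^ 2)) => //; first by move=> x y hx hy; rewrite maxnE; lia.
by move=> G /andP[sG _]; have := card_edges_le G sG; rewrite card_ord.
Qed.

Lemma min_value (d : nat -> nat) (m0 : nat) :
  exists2 m, m0 <= m & forall n, m0 <= n -> d m <= d n.
Proof.
have [k] := ubnP (d m0); move: (leqnn m0); move: {2 3}m0.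
elim: k => // k IH m lem ltk.
have [hm|/existsNP[n /not_implyP[len /negP]]] := pselect (forall n, m0 <= n -> d m <= d n).
  by exists m.
rewrite -ltnNge => ltn; apply: IH len _; exact: leq_trans ltn _.
Qed.

(** This replaces the existence of the limit of ex(n, F) / n^2: if m
    minimises the density rounded to a multiple of 1 / q, all other densities are
    at least that of m up to the rounding error. *)
Lemma turan_density_min {S : finType} (F : {set {set S}}) (q m0 : nat) : 0 < m0 ->
  exists2 m, m0 <= m & forall n, m0 <= n ->
   q * turan_number m F * n ^ 2 <= (q * turan_number n F + n ^ 2) * m ^ 2.
Proof.
move=> m0pos; pose d n := q * turan_number n F %/ n ^ 2.
have [m lem hm] := min_value d m0.
exists m => // n len; have npos : 0 < n ^ 2 by rewrite expn_gt0; lia.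
have mpos : 0 < m ^ 2 by rewrite expn_gt0; lia.
have := hm n len; rewrite /d.
set x := q * turan_number m F; set y := q * turan_number n F => le.
have h1 := ltn_ceil x mpos.
have h2 := leq_divM y (n ^ 2).
have h3 : x <= (y %/ n ^ 2).+1 * m ^ 2.
  by rewrite (leq_trans (ltnW h1)) // leq_mul2r ltnS le orbT.
apply: (@leq_trans ((y %/ n ^ 2).+1 * m ^ 2 * n ^ 2)); first by rewrite leq_mul2r h3 orbT.
by rewrite mulnAC leq_mul2r mulSn addnC leq_add2r h2 orbT.
Qed.

(** The arithmetic of supersaturation.  Here A = n ^ m is the number of maps from
    [m] to [n], B = n ^ 2, x and y are the Turan numbers of m and n, e is the
    number of edges of G, S the total number of edges of all pullbacks and g the
    number of pullbacks with more than x edges.  The condition m >= q + 2 pays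
    for the loss caused by the maps that are not injective, a fraction 1 / m of
    at most m ^ 2 / 2 edges. *)
Lemma supersaturation_arith (q m A B S x y e g : nat) : 0 < B ->
  B * S = m * m.-1 * e * A -> 2 * S <= m ^ 2 * g + 2 * x * A -> 2 * x <= m ^ 2 ->
  2 * q * x * B <= (2 * q * y + B) * m ^ 2 -> q * y + B <= q * e -> q.+2 <= m ->
  A <= q * m * g.
Proof.
case: m => // p; rewrite -!mulnn /= => Bpos sumE up exm dm dG lem.
have h1 : p * A * (2 * (q * y + B) * (p.+1 * p.+1)) <= q * p.+1 * (2 * (B * S)).
  rewrite sumE (_ : q * p.+1 * _ = p * A * (2 * (q * e) * (p.+1 * p.+1))); last by ring.
  by rewrite leq_mul2l leq_mul2r !leq_mul2l dG !orbT.
have h2 : p * A * ((2 * q * x + p.+1 * p.+1) * B) <= q * p.+1 * (2 * (B * S)).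
  apply: leq_trans h1; rewrite leq_mul2l; apply/orP; right.
  by rewrite mulnDl (leq_trans (leq_add dm (leqnn _))) //; apply: eq_leq; ring.
have h3 : p * A * (2 * q * x + p.+1 * p.+1) <= q * p.+1 * (p.+1 * p.+1 * g + 2 * x * A).
  rewrite -(leq_pmul2r Bpos) -mulnA (leq_trans h2) //.
  rewrite (_ : q * p.+1 * (2 * (B * S)) = q * p.+1 * B * (2 * S)); last by ring.
  rewrite [X in _ <= X](_ : _ = q * p.+1 * B * (p.+1 * p.+1 * g + 2 * x * A)); last by ring.
  by rewrite leq_mul2l up orbT.
have h4 : p * A * (p.+1 * p.+1) <= q * p.+1 * (p.+1 * p.+1 * g) + q * A * (2 * x).
  rewrite -(leq_add2l (p * A * (2 * q * x))) -mulnDr (leq_trans h3) //.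
  by apply: eq_leq; rewrite -[in LHS]addn1 -[in RHS]addn1; ring.
have h5 : p * A * (p.+1 * p.+1) <= (q * p.+1 * g + q * A) * (p.+1 * p.+1).
  rewrite (leq_trans h4) // mulnDl leq_add ?leq_mul2l ?exm ?orbT //.
  by apply: eq_leq; ring.
rewrite leq_pmul2r // in h5; nia.
Qed.

(** By supersaturation, a positive proportion of the maps from [m] pull G back to
    one and the same graph F containing K_r.  A product of large sets consisting
    of such maps is a blow-up of F in G, so it contains one of K_r. *)
Lemma blowup_of_dense (r s q : nat) : 0 < s -> 0 < q ->
  exists N, forall n (G : {set {set 'I_n}}), N <= n -> simple_graph G ->
    q * turan_number n (complete_graph 'I_r) + n ^ 2 <= q * #|G| ->
    exists V : 'I_r -> {set 'I_n}, [/\ forall i, #|V i| = s,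
      forall i j, i != j -> [disjoint V i & V j] & edges_across V \subset G].
Proof.
move=> spos qpos; set K := complete_graph 'I_r.
have [m lem hm] := turan_density_min K (2 * q) q.+2 isT.
have [N hN] := dense_product m s (q * m * 2 ^ (2 ^ m)) spos.
exists (maxn N q.+2) => n G; rewrite geq_max => /andP[leN len] sG dG.
pose good := [set f : {ffun 'I_m -> 'I_n} | turan_number m K < #|pullback G f|].
have npos : 0 < n ^ m by rewrite expn_gt0; lia.
have n2pos : 0 < n ^ 2 by rewrite expn_gt0; lia.
have many : n ^ m <= q * m * #|good|.
  have := @sum_pullback 'I_m 'I_n G sG; rewrite !card_ord => sumE.
  have up : \sum_(f : {ffun 'I_m -> 'I_n}) 2 * #|pullback G f| <=
      m ^ 2 * #|good| + 2 * turan_number m K * n ^ m.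
    have -> : n ^ m = #|{ffun 'I_m -> 'I_n}| by rewrite card_ffun !card_ord.
    have -> : good = [set f : {ffun 'I_m -> 'I_n} | 2 * turan_number m K < 2 * #|pullback G f|].
      by apply/setP=> f; rewrite !inE ltn_pmul2l.
    rewrite card_set_sum big_distrr /= [X in _ + X]mulnC -sum_nat_const -big_split /=.
    apply: leq_sum => f _; case: (ltnP (2 * turan_number m K) (2 * #|pullback G f|)) => h.
      by rewrite muln1 (leq_trans (card_edges_le _ (pullback_simple _ _))) ?card_ord ?leq_addr.
    by rewrite muln0.
  rewrite -big_distrr /= in up.
  have exm := turan_le m _ K; have dm := hm n len.
  exact: (supersaturation_arith _ _ _ _ _ _ _ _ _ n2pos sumE up exm dm dG lem).
have [f0 f0g] : exists f, f \in good.
  by apply/card_gt0P; have := leq_trans npos many; rewrite muln_gt0 => /andP[].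
pose big := [set F : {set {set 'I_m}} | simple_graph F && (turan_number m K < #|F|)].
have bigI : {in good, forall f, pullback G f \in big}.
  by move=> f; rewrite !inE pullback_simple.
have big0 : big != set0 by apply/set0Pn; exists (pullback G f0); exact: bigI.
have [F Fbig] := pigeonhole good big (pullback G) big0 bigI.
set H := [set _ in good | _] => leH.
(* F is the most frequent of these pullbacks; [m] carries at most 2 ^ (2 ^ m)
   sets of edges. *)
have cbig : #|big| <= 2 ^ (2 ^ m).
  have cset (T : finType) : #|{set T}| = 2 ^ #|T|.
    by rewrite -[LHS]cardsT -[[set: {set T}]]powersetT card_powerset cardsT.
  by rewrite (leq_trans (max_card _)) // !cset card_ord.
have dH : #|'I_n| ^ m <= q * m * 2 ^ (2 ^ m) * #|H|.
  rewrite card_ord (leq_trans many) // -[X in _ <= X]mulnA leq_mul2l (leq_trans leH) ?orbT //.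
  by rewrite leq_mul2r cbig orbT.
have [V [cV hV]] := hN 'I_n H (leq_trans leN (eq_leq (esym (card_ord n)))) dH.
move: Fbig; rewrite inE => /andP[sF ltF].
have /existsP[g /andP[/injectiveP ginj /forall_inP gK]] := gt_turan_copy _ _ _ _ sF ltF.
have pick_V i : exists x, x \in V i by apply/card_gt0P; rewrite cV.
have edge i j x y : i != j -> x \in V (g i) -> y \in V (g j) -> [set x; y] \in G.
  move=> ij xV yV.
  pose f := [ffun k => if k == g i then x else if k == g j then y else xchoose (pick_V k)].
  have : f \in H.
    apply: hV => k; rewrite ffunE; case: eqP => [->//|_].
    by case: eqP => [->//|_]; exact: xchooseP.
  rewrite inE => /andP[_ /eqP fF].
  have : [set g i; g j] \in F.
    have <- : g @: [set i; j] = [set g i; g j] by rewrite imsetU1 imset_set1.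
    by apply: gK; rewrite inE cards2 ij.
  by rewrite -fF mem_pullback // !ffunE eqxx (inj_eq ginj) eq_sym (negbTE ij) eqxx.
exists (V \o g); split => [i|i j ij|]; first exact: cV.
  apply/pred0P=> x /=; apply/negP=> /andP[xi xj].
  by have := edge i j x x ij xi xj; rewrite loop_notin.
apply/subsetP=> e; rewrite inE => /andP[_ /existsP[i /existsP[j /andP[ij]]]].
by case/exists_inP=> x xi /exists_inP[y yj /eqP->]; exact: edge ij xi yj.
Qed.

(** * Edges within a set and across classes *)

Lemma mem_within {T : finType} (A e : {set T}) :
  reflect (exists x y, [/\ x != y, x \in A, y \in A & e = [set x; y]]) (e \in edges_within A).
Proof.
rewrite !inE; apply: (iffP andP) => [[/cards2P[x [y [xy ->]]]]|[x [y [xy xA yA ->]]]].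
  by rewrite subUset !sub1set => /andP[xA yA]; exists x, y.
by rewrite cards2 xy subUset !sub1set xA yA.
Qed.

Lemma mem_across {T : finType} {r} (V : 'I_r -> {set T}) (e : {set T}) :
  (forall i j, i != j -> [disjoint V i & V j]) ->
  reflect (exists i j x y, [/\ i != j, x \in V i, y \in V j & e = [set x; y]])
    (e \in edges_across V).
Proof.
move=> dV; rewrite !inE; apply: (iffP andP) => [[_ /existsP[i /existsP[j]]]|].
  by case/andP=> ij /exists_inP[x xi /exists_inP[y yj /eqP ->]]; exists i, j, x, y.
case=> i [j [x [y [ij xi yj ->]]]]; split.
  rewrite cards2; case: (eqVneq x y) => // exy.
  by have /pred0P/(_ x) := dV i j ij; rewrite /= xi exy yj.
apply/existsP; exists i; apply/existsP; exists j; rewrite ij /=.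
by apply/exists_inP; exists x => //; apply/exists_inP; exists y.
Qed.

Lemma edges_withinS {T : finType} (A B : {set T}) : A \subset B ->
  edges_within A \subset edges_within B.
Proof.
move=> AB; apply/subsetP=> e; rewrite !inE => /andP[-> eA]; exact: subset_trans eA AB.
Qed.

Lemma edges_acrossS {T : finType} {r} (V W : 'I_r -> {set T}) : (forall i, V i \subset W i) ->
  edges_across V \subset edges_across W.
Proof.
move=> VW; apply/subsetP=> e; rewrite !inE => /andP[-> /existsP[i /existsP[j /andP[ij]]]].
case/exists_inP=> x xi /exists_inP[y yj ee].
apply/existsP; exists i; apply/existsP; exists j; rewrite ij /=.
apply/exists_inP; exists x; first exact: subsetP (VW i) x xi.
by apply/exists_inP; exists y; first exact: subsetP (VW j) y yj.
Qed.

(** * The canonical Ramsey theorem for pairs *)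

Definition canonically_colored {T : finType} {C : eqType} (psi : {set T} -> C)
    (A : {set T}) : Prop :=
  [\/ monochromatic psi (edges_within A), rainbow psi (edges_within A) | lex_colored psi A].

(** A random map f from [t] into A works.  It fails if f b = f a for some a and b,
    or if distinct pairs {a, b} and {c, e} of indices receive the same color; in
    the second case b lies outside {c, e}, up to exchanging a and b.  Either way,
    once the other images are fixed, f b is one of the at most d vertices that are
    f a or joined to f a by an edge of a given color. *)
Lemma rainbow_subset {T : finType} {C : eqType} (psi : {set T} -> C) (A : {set T}) (t d : nat) :
  t ^ 4 * d < #|A| ->
  (forall v c, v \in A -> #|[set x in A | (x == v) || (psi [set v; x] == c)]| <= d) ->
  exists B : {set T}, [/\ B \subset A, #|B| = t & rainbow psi (edges_within B)].
Proof.
move=> ltA deg; pose S := {x | x \in A}.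
pose K : finType := ('I_t * 'I_t * ('I_t * 'I_t))%type.
pose P (k : K) : pred {ffun 'I_t -> S} := fun f =>
  let: (a, b, (c, e)) := k in
  [&& a != b, b != c, b != e &
     (f b == f a) || (psi [set val (f a); val (f b)] == psi [set val (f c); val (f e)])].
have [|[[a b] [c e]] f|f hf] := @avoid_bad_events 'I_t S K (fun k => k.1.2) P d.
- rewrite !card_prod !card_ord card_sig; apply: leq_ltn_trans ltA.
  by rewrite !expnS muln1 !mulnA.
- case: (boolP [&& a != b, b != c & b != e]) => [/and3P[ab bc be]|h]; last first.
    rewrite eq_card0 // => x; rewrite !inE /=; apply/negbTE; apply: contra h.
    by case/and4P => -> -> ->.
  have := deg (val (f a)) (psi [set val (f c); val (f e)]) (valP (f a)).
  apply: leq_trans; rewrite -(card_imset _ val_inj); apply: subset_leq_card.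
  apply/subsetP=> _ /imsetP[x xP ->]; move: xP; rewrite !inE (valP x) /= !ffunE eqxx.
  by rewrite ab bc be (negbTE ab) ![_ == b]eq_sym (negbTE bc) (negbTE be) val_eqE.
have finj : injective f.
  move=> a b fab; apply/eqP; rewrite -[_ == _]negbK; apply/negP=> ab.
  by have := hf (a, b, (a, a)); rewrite /= ab (eq_sym b) ab fab eqxx.
have vinj : injective (fun i => val (f i)) by move=> i j /val_inj /finj.
exists [set val (f i) | i : 'I_t]; split.
- by apply/subsetP=> _ /imsetP[i _ ->]; exact: valP.
- by rewrite card_imset // card_ord.
have key a b c e : a != b -> b != c -> b != e ->
    psi [set val (f a); val (f b)] = psi [set val (f c); val (f e)] -> False.
  move=> ab bc be eq; have := hf (a, b, (c, e)).
  by rewrite /= ab bc be eq eqxx orbT.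
move=> e1 e2 /mem_within[x1 [y1 [ab /imsetP[a _ ax] /imsetP[b _ bx] ->]]].
move=> /mem_within[x2 [y2 [ce /imsetP[c _ cx] /imsetP[e _ ex] ->]]]; subst => eq.
have {}ab : a != b by apply: contraNneq ab => ->.
have {}ce : c != e by apply: contraNneq ce => ->.
case: (boolP ((b != c) && (b != e))) => [/andP[h1 h2]|hb]; first by case: (key a b c e).
case: (boolP ((a != c) && (a != e))) => [/andP[h1 h2]|ha].
  by case: (key b a c e) => //; rewrite 1?eq_sym // setUC.
(* Both a and b are in {c, e}, so the two pairs coincide. *)
move: ha hb; rewrite !negb_and !negbK => /orP[] /eqP ha /orP[] /eqP hb; subst => //;
  rewrite ?eqxx // in ab ce *; by rewrite setUC.
Qed.

(** Every vertex comes with the common color of its edges to all later ones. *)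
Definition end_homogeneous {T : finType} {C : eqType} (psi : {set T} -> C) (p : seq (T * C)) :=
  pairwise (fun u w => (u.1 != w.1) && (psi [set u.1; w.1] == u.2)) p.

Lemma end_homogeneous_uniq {T : finType} {C : eqType} (psi : {set T} -> C) (p : seq (T * C)) :
  end_homogeneous psi p -> uniq (map fst p).
Proof.
move=> h; rewrite uniq_pairwise pairwise_map; apply: sub_pairwise h => u w /=.
by case/andP.
Qed.

Lemma end_homogeneous_edge {T : finType} {C : eqType} (psi : {set T} -> C) (p : seq (T * C)) u w :
  end_homogeneous psi p -> u \in p -> w \in p -> u.1 != w.1 ->
  psi [set u.1; w.1] = u.2 \/ psi [set u.1; w.1] = w.2.
Proof.
elim: p => // z p IH; rewrite /end_homogeneous pairwise_cons => /andP[/allP hz hp].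
rewrite !inE => /orP[/eqP->|up] /orP[/eqP->|wp] uw; first by rewrite eqxx in uw.
- by left; have /andP[_ /eqP] := hz w wp.
- by right; rewrite setUC; have /andP[_ /eqP] := hz u up.
exact: IH.
Qed.

Lemma end_homogeneous_mono {T : finType} {C : eqType} (psi : {set T} -> C) (p : seq (T * C)) c :
  end_homogeneous psi p -> all (fun u => u.2 == c) p ->
  monochromatic psi (edges_within [set x in map fst p]).
Proof.
move=> hp /allP hc.
have col e : e \in edges_within [set x in map fst p] -> psi e = c.
  case/mem_within=> x [y [xy]]; rewrite !inE => /mapP[u up xE] /mapP[w wp yE] ->; subst.
  by case: (end_homogeneous_edge _ _ u w hp up wp xy) => ->; apply/eqP/hc.
by move=> e f he hf; rewrite !col.
Qed.

(** The order has to be reversed: here the color of an edge is determined by its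
    earlier end, whereas in a LEX-coloring it is determined by the later one. *)
Lemma end_homogeneous_lex {T : finType} {C : eqType} (psi : {set T} -> C) (p : seq (T * C)) :
  p != [::] -> end_homogeneous psi p -> uniq (map snd p) ->
  lex_colored psi [set x in map fst p].
Proof.
case: p => // p0 p' _; set p := p0 :: p' => hp ucol.
have uv := end_homogeneous_uniq _ _ hp.
set A := [set _ in _].
have cA : #|A| = size p by rewrite cardsE (card_uniqP uv) size_map.
pose s := rev p; have ss : size s = size p by rewrite size_rev.
have us1 : uniq (map fst s) by rewrite map_rev rev_uniq.
have us2 : uniq (map snd s) by rewrite map_rev rev_uniq.
have lt (i : 'I_#|A|) : i < size s by rewrite ss -cA.
exists (fun i => (nth p0 s i).1), (fun k => (nth p0 s k).2); split.
- move=> i j; rewrite -!(nth_map _ p0.1) //= => /eqP.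
  by rewrite nth_uniq ?size_map // => /eqP /val_inj.
- apply/setP=> x; rewrite inE; apply/imsetP/idP => [[i _ ->]|].
    by apply: map_f; rewrite -mem_rev mem_nth.
  rewrite -mem_rev -map_rev => /(nthP p0.1)[i]; rewrite size_map => ltis <-.
  have ltA : i < #|A| by rewrite cA -ss.
  by exists (Ordinal ltA) => //=; rewrite (nth_map p0).
- move=> i j; rewrite !inE => /andP[_ iA] /andP[_ jA].
  rewrite cA -ss in iA jA.
  rewrite -!(nth_map p0 p0.2 snd) // => /eqP.
  by rewrite nth_uniq ?size_map // => /eqP.
move=> i j ltij.
have := lt i; have := lt j; rewrite ss => ltj lti.
rewrite !nth_rev //.
have /(pairwiseP p0) /(_ (size p - j.+1) (size p - i.+1)) := hp.
rewrite !inE; case/(_ _ _ _)/andP; rewrite ?ltn_subrL //; first by lia.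
by move=> _ /eqP; rewrite setUC.
Qed.

Lemma color_pigeonhole {T C : eqType} (t k : nat) (p : seq (T * C)) : 0 < t -> k * t <= size p ->
  exists2 q, subseq q p & (size q = t /\ exists c, all (fun u => u.2 == c) q) \/
     (size q = k /\ uniq (map snd q)).
Proof.
move=> tpos; elim: k p => [|k IH] p; first by exists [::]; rewrite ?sub0seq //; right.
case: p => [|u p]; first by rewrite mulSn; case: t tpos {IH}.
set c := u.2; case: (leqP t (count (fun w => w.2 == c) (u :: p))) => hc hs.
  exists (take t [seq w <- u :: p | w.2 == c]).
    exact: subseq_trans (take_subseq _ _) (filter_subseq _ _).
  left; split; first by rewrite size_takel // size_filter.
  exists c; apply/allP=> w /mem_take; by rewrite mem_filter => /andP[].
have [|q qp hq] := IH [seq w <- p | w.2 != c].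
  rewrite size_filter; move: hc hs; rewrite /= eqxx mulSn add1n.
  have <- : count (fun w => w.2 == c) p + count (fun w => w.2 != c) p = size p.
    exact: count_predC.
  by move: (count _ p) (count _ p) => x y; lia.
case: hq => [hq|[sq uq]].
  exists q; last by left.
  apply: subseq_trans qp _; apply: subseq_trans (filter_subseq _ _) (subseq_cons _ _).
exists (u :: q); last right.
  by rewrite /= eqxx; exact: subseq_trans qp (filter_subseq _ _).
rewrite /= sq uq andbT; split=> //; apply/negP=> /mapP[w wq cw].
by have := mem_subseq qp wq; rewrite mem_filter /c cw eqxx.
Qed.

(** Keep moving to the neighbourhood of a vertex in a color of relative degree
    above 1 / D.  Either this succeeds k times, or it stops at a set, still large,
    where no vertex has such a color. *)
Lemma homogeneous_or_sparse (D M k : nat) : exists N, forall (T : finType) (C : eqType)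
    (psi : {set T} -> C) (A : {set T}), N <= #|A| ->
  (exists A' : {set T}, [/\ A' \subset A, M <= #|A'| &
     forall v c, v \in A' ->
       D * #|[set x in A' | (x != v) && (psi [set v; x] == c)]| <= #|A'|])
  \/ exists p : seq (T * C), [/\ size p = k, all (fun u => u.1 \in A) p & end_homogeneous psi p].
Proof.
elim: k => [|k [N IH]]; first by exists 0 => T C psi A _; right; exists [::].
exists (maxn M (D * N)) => T C psi A; rewrite geq_max => /andP[leM leN].
pose nb v c := [set x in A | (x != v) && (psi [set v; x] == c)].
case: (boolP [exists v in A, exists y in A, #|A| < D * #|nb v (psi [set v; y])|]); last first.
  move=> sparse; left; exists A; split=> // v c vA.
  rewrite -/(nb v c); have [->|[y]] := set_0Vmem (nb v c); first by rewrite cards0 muln0.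
  rewrite inE => /and3P[yA _ /eqP <-]; rewrite leqNgt; apply: contra sparse => h.
  by apply/exists_inP; exists v => //; apply/exists_inP; exists y.
case/exists_inP=> v vA /exists_inP[y yA dense].
set c := psi _ in dense.
have leN2 : N <= #|nb v c|.
  by have := leq_ltn_trans leN dense; rewrite ltn_mul2l => /andP[_ /ltnW].
have nbA : nb v c \subset A by apply/subsetP=> x; rewrite inE => /andP[].
case: (IH T C psi _ leN2) => [[A' [A'nb hM hs]]|[p [sp pA hp]]]; [left|right].
  by exists A'; split=> //; exact: subset_trans A'nb nbA.
exists ((v, c) :: p); split; first by rewrite /= sp.
  by rewrite /= vA; apply: sub_all pA => u; apply: subsetP.
rewrite /end_homogeneous pairwise_cons [pairwise _ _]hp andbT; apply: sub_all pA => u /=.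
by rewrite inE eq_sym => /andP[].
Qed.

(** The sequence has length t * t, so that it has t vertices of the same color or t
    vertices of distinct colors.  The value of D makes the degree bound
    #|A'| / D + 1 smaller than #|A'| / t ^ 4, as required by the union bound. *)
Lemma canonical_ramsey (t : nat) : 0 < t -> exists N, forall (T : finType) (C : eqType)
    (psi : {set T} -> C) (A : {set T}), N <= #|A| ->
  exists B : {set T}, [/\ B \subset A, #|B| = t & canonically_colored psi B].
Proof.
move=> tpos; pose D := 2 * t ^ 4.
have [N hN] := homogeneous_or_sparse D D.+1 (t * t).
exists N => T C psi A /(hN T C psi A)[[A' [A'A ltA' sparse]]|[p [sp pA hp]]].
  have [||B [BA' cB rB]] := rainbow_subset psi A' t (#|A'| %/ D).+1.
  - have := leq_divM #|A'| D; rewrite mulnC /D in ltA' *; lia.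
  - move=> v c vA'; have := sparse v c vA'.
    set S := [set x in A' | _] => le.
    apply: (@leq_trans #|v |: S|).
      apply: subset_leq_card; apply/subsetP=> x; rewrite !inE => /andP[-> /=].
      by case: (x == v).
    rewrite cardsU1 -[_.+1]add1n leq_add ?leq_b1 // leq_divRL 1?mulnC //.
    by rewrite /D muln_gt0 expn_gt0 tpos.
  by exists B; split=> //; [exact: subset_trans BA' A'A | apply: Or32].
have [q qp hq] := color_pigeonhole t t p tpos (eq_leq (esym sp)).
have hpq : end_homogeneous psi q by exact: subseq_pairwise qp hp.
have sq : size q = t by case: hq => -[].
exists [set x in map fst q]; split.
- apply/subsetP=> x; rewrite inE => /mapP[u uq ->]; apply: (allP pA); exact: mem_subseq qp _ uq.
- by rewrite cardsE (card_uniqP (end_homogeneous_uniq _ _ hpq)) size_map.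
case: hq => [[_ [c hc]]|[_ uq]]; first by apply: Or31; exact: end_homogeneous_mono hpq hc.
apply: Or33; apply: end_homogeneous_lex => //; by rewrite -size_eq0 sq -lt0n.
Qed.

(** * From many colors to a clean rainbow blow-up *)

Lemma rainbow_representatives {T : finType} {C : eqType} (psi : {set T} -> C) :
  exists G : {set {set T}}, [/\ simple_graph G, rainbow psi G & num_colors psi <= #|G|].
Proof.
set K := complete_graph T.
pose rep e := [pick f in K | psi f == psi e].
exists [set e in K | rep e == Some e]; split.
- by apply/subsetP=> e; rewrite inE => /andP[].
- move=> e f; rewrite !inE => /andP[_ /eqP re] /andP[_ /eqP rf] ef.
  have : rep e = rep f by apply: eq_pick => z; rewrite ef.
  by rewrite re rf => -[].
set G := [set e in K | _]; rewrite /num_colors cardE -(size_map psi).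
apply: uniq_leq_size; first exact: undup_uniq.
move=> c; rewrite mem_undup => /imageP[e eK ->].
case E : (rep e) => [f|]; last first.
  by move: E; rewrite /rep; case: pickP => // /(_ e); rewrite eK eqxx.
have /andP[fK /eqP fe] : (f \in K) && (psi f == psi e).
  by move: E; rewrite /rep; case: pickP => // g hg [<-].
apply/mapP; exists f => //; rewrite mem_enum inE fK /= -E; apply/eqP.
by apply: eq_pick => z; rewrite fe.
Qed.

Lemma disjoint_blocks {T : finType} (m N : nat) (A : {set T}) : m * N <= #|A| ->
  exists B : 'I_m -> {set T}, [/\ forall a, B a \subset A, forall a, #|B a| = N &
     forall a b, a != b -> [disjoint B a & B b]].
Proof.
elim: m A => [|m IH] A leA; first by exists (fun _ => set0); split=> -[].
have [B0 B0A cB0] := subset_of_card A N (leq_trans (leq_addr _ _) leA).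
have [|B [BA cB dB]] := IH (A :\: B0).
  by rewrite cardsDS // cB0 leq_subRL ?(leq_trans (leq_addr _ _) leA).
have dB0 a : [disjoint B0 & B a].
  rewrite disjoint_sym; apply: disjointWl (BA a) _.
  by rewrite disjoints_subset setDE subsetIr.
exists (fun a => if unlift ord0 a is Some b then B b else B0); split.
- move=> a; case: unliftP => // b _; exact: subset_trans (BA b) (subsetDl _ _).
- by move=> a; case: unliftP.
move=> a b; case: unliftP => [a' ->|->]; case: unliftP => [b' ->|->] //.
- by rewrite (inj_eq lift_inj); exact: dB.
by rewrite disjoint_sym.
Qed.

(** Choose the blocks at random.  A conflict is a pair e inside the block chosen in
    class i with the color of some xy, where x is in the block chosen in class j
    and y in that of class k.  Since j and k differ, one of them is not i, and it
    may be taken to be k.  Given the blocks in all other classes, the conflict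
    determines the block of y: as the edges across are rainbow, e determines xy.
    So at most one block of class k is excluded for each set e inside the block
    of class i, that is, at most 2 ^ N blocks. *)
Lemma clean_blocks {T : finType} {C : eqType} (psi : {set T} -> C) (r m N : nat)
    (V : 'I_r -> {set T}) (B : 'I_r -> 'I_m -> {set T}) :
  (forall i j, i != j -> [disjoint V i & V j]) -> rainbow psi (edges_across V) ->
  (forall i a, B i a \subset V i) -> (forall i a, #|B i a| = N) ->
  (forall i a b, a != b -> [disjoint B i a & B i b]) ->
  r ^ 3 * 2 ^ N < m ->
  exists phi : {ffun 'I_r -> 'I_m}, forall i e f,
    e \in edges_within (B i (phi i)) -> f \in edges_across (fun i => B i (phi i)) ->
    psi e <> psi f.
Proof.
move=> dV rV BV cB dB ltm.
have dBV i j x : x \in V i -> x \in V j -> i = j.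
  by move=> xi xj; apply/eqP; apply: contraT => /dV /pred0P/(_ x); rewrite /= xi xj.
pose K : finType := ('I_r * ('I_r * 'I_r))%type.
pose P (k : K) : pred {ffun 'I_r -> 'I_m} := fun phi =>
  let: (i, (j, k)) := k in [&& i != k, j != k &
    [exists e in edges_within (B i (phi i)),
      [exists x in B j (phi j), [exists y in B k (phi k), psi e == psi [set x; y]]]]].
have [||phi hphi] := @avoid_bad_events 'I_r 'I_m K (fun k => k.2.2) P (2 ^ N).
- by rewrite !card_prod !card_ord; apply: leq_ltn_trans ltm; rewrite !expnS muln1.
- move=> [i [j k]] phi /=.
  case: (boolP ((i != k) && (j != k))) => [/andP[ik jk]|h]; last first.
    rewrite eq_card0 // => x; rewrite !inE; apply/negbTE; apply: contra h.
    by case/and3P => -> ->.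
  rewrite -(cB i (phi i)) -card_powerset.
  set X := [set x | _].
  have wit x : x \in X -> exists e, [&& e \in edges_within (B i (phi i)) &
      [exists u in B j (phi j), [exists y in B k x, psi e == psi [set u; y]]]].
    rewrite inE => /and3P[_ _ /exists_inP[e]]; rewrite !ffunE (negbTE ik) (negbTE jk) eqxx.
    by move=> he hu; exists e; rewrite he.
  pose g x := if pselect (x \in X) is left h then xchoose (wit x h) else set0.
  have gP x : x \in X -> [&& g x \in edges_within (B i (phi i)) &
      [exists u in B j (phi j), [exists y in B k x, psi (g x) == psi [set u; y]]]].
    by move=> xX; rewrite /g; case: pselect => // h; exact: (xchooseP (wit x h)).
  rewrite -(card_in_imset (f := g) (D := mem X)).
    apply: subset_leq_card; apply/subsetP=> _ /imsetP[x xX ->].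
    by have /andP[] := gP x xX; rewrite !inE => /andP[].
  move=> x x' xX x'X gx.
  have /andP[_ /exists_inP[u uj /exists_inP[y yk /eqP hxy]]] := gP x xX.
  have /andP[_ /exists_inP[u' uj' /exists_inP[y' yk' /eqP hxy']]] := gP x' x'X.
  have acr u0 y0 x0 : u0 \in B j (phi j) -> y0 \in B k x0 -> [set u0; y0] \in edges_across V.
    move=> hu hy; apply/mem_across => //; exists j, k, u0, y0; split=> //.
      exact: subsetP (BV _ _) _ hu.
    exact: subsetP (BV _ _) _ hy.
  have eq2 : [set u; y] = [set u'; y'].
    by apply: rV; [exact: acr uj yk | exact: acr uj' yk' | rewrite -hxy -hxy' gx].
  have yy : y = y'.
    case: (set2_eq _ _ _ _ eq2) => -[] // uy _.
    have uj2 := subsetP (BV _ _) _ uj; have yk2 := subsetP (BV _ _) _ yk'.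
    by rewrite uy in uj2; rewrite (dBV _ _ _ uj2 yk2) eqxx in jk.
  apply/eqP; apply: contraT => /(dB k) /pred0P/(_ y).
  by rewrite /= yk yy yk'.
exists phi => i e f he.
have dW j k : j != k -> [disjoint B j (phi j) & B k (phi k)].
  move=> jk; apply: disjointWl (BV _ _) _; apply: disjointWr (BV _ _) _; exact: dV.
case/mem_across => // j [k [x [y [jk xj yk ->]]]] eq.
have key i' j' k' x' y' : i' = i -> j' != k' -> i' != k' ->
    x' \in B j' (phi j') -> y' \in B k' (phi k') -> psi e = psi [set x'; y'] -> False.
  move=> -> jk' ik' xj' yk' ee; have /negP := hphi (i, (j', k')); apply; rewrite /= ik' jk' /=.
  apply/exists_inP; exists e => //; apply/exists_inP; exists x' => //.
  by apply/exists_inP; exists y' => //; apply/eqP.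
case: (eqVneq i k) => [ik|ik]; last exact: (key i j k x y).
apply: (key i k j y x) => //; last by rewrite setUC.
  by rewrite eq_sym.
by rewrite ik eq_sym.
Qed.

Definition has_clean_blowup {T : finType} {C : eqType} (psi : {set T} -> C) (r t : nat) : Prop :=
  exists V : 'I_r -> {set T},
    [/\ partite_classes t V,
        rainbow psi (edges_across V),
        forall i, canonically_colored psi (V i)
      & forall i e f, e \in edges_within (V i) -> f \in edges_across V ->
          psi e <> psi f].

Lemma clean_blowup_of_many_colors (r t q : nat) : 0 < t -> 0 < q ->
  exists N, forall n (C : eqType) (psi : {set 'I_n} -> C), N <= n ->
    q * turan_number n (complete_graph 'I_r) + n ^ 2 <= q * num_colors psi ->
    has_clean_blowup psi r t.
Proof.
move=> tpos qpos.
have [M0 hM0] := canonical_ramsey t tpos.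
(* The successor keeps the blocks nonempty. *)
pose M := M0.+1.
pose m := (r ^ 3 * 2 ^ M).+1.
have spos : 0 < m * M by [].
have [N hN] := blowup_of_dense r (m * M) q spos qpos.
exists N => n C psi leN dens.
have [G [sG rG cG]] := rainbow_representatives psi.
have dG : q * turan_number n (complete_graph 'I_r) + n ^ 2 <= q * #|G|.
  by apply: leq_trans dens _; rewrite leq_mul2l cG orbT.
have [V [cV dV VG]] := hN n G leN sG dG.
have rV : rainbow psi (edges_across V) by move=> e f he hf; apply: rG; exact: subsetP VG _ _.
have hB i : exists B : 'I_m -> {set 'I_n}, [/\ forall a, B a \subset V i, forall a, #|B a| = M &
     forall a b, a != b -> [disjoint B a & B b]] by apply: disjoint_blocks; rewrite cV.
have [B hB'] := choice hB.
have [phi hphi] := clean_blocks psi r m M V B dV rV (fun i => let: And3 h _ _ := hB' i in h)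
  (fun i => let: And3 _ h _ := hB' i in h) (fun i => let: And3 _ _ h := hB' i in h) (leqnn _).
have hU i : exists U : {set 'I_n}, [/\ U \subset B i (phi i), #|U| = t & canonically_colored psi U].
  by apply: hM0; have [_ -> _] := hB' i; exact: leqnSn.
have [U hU'] := choice hU.
have UB i : U i \subset B i (phi i) by have [] := hU' i.
have UV i : U i \subset V i by apply: subset_trans (UB i) _; have [->] := hB' i.
exists U; split.
- split=> [i|i j ij]; first by have [] := hU' i.
  by apply: disjointWl (UV i) _; apply: disjointWr (UV j) _; exact: dV.
- by move=> e f he hf; apply: rV; exact: subsetP (edges_acrossS _ _ UV) _ _.
- by move=> i; have [] := hU' i.
move=> i e f he hf; apply: (hphi i).
  exact: subsetP (edges_withinS _ _ (UB i)) _ he.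
exact: (subsetP (edges_acrossS U (fun i => B i (phi i)) UB)).
Qed.

(** * The error term *)

Definition unstructured (r t n k : nat) : Prop :=
  exists (C : eqType) (psi : {set 'I_n} -> C),
    num_colors psi = k /\ ~ has_clean_blowup psi r t.

(** A coloring has at most as many colors as there are sets of vertices, so the
    bound on k loses nothing. *)
Definition color_excess (r t n : nat) : nat :=
  (\max_(k < #|{set 'I_n}|.+1 | `[< unstructured r t n k >]) k
    - turan_number n (complete_graph 'I_r))%N.

Lemma unstructured_le_excess (r t n k : nat) : unstructured r t n k ->
  (k <= turan_number n (complete_graph 'I_r) + color_excess r t n)%N.
Proof.
move=> bad; rewrite -leq_subLR leq_sub2r //.
have ltk : (k < #|{set 'I_n}|.+1)%N.
  case: bad => C [psi [<- _]]; rewrite ltnS /num_colors (leq_trans (size_undup _)) //.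
  by rewrite size_map -cardE max_card.
apply: (@leq_bigmax_cond _ (fun k : 'I__ => `[< unstructured r t n k >])
  (fun k => k : nat) (Ordinal ltk)).
exact/asboolP.
Qed.

Lemma color_excess_small (r t q : nat) : (0 < t)%N -> (0 < q)%N ->
  exists N, forall n, (N <= n)%N -> (q * color_excess r t n <= n ^ 2)%N.
Proof.
move=> tpos qpos; have [N hN] := clean_blowup_of_many_colors r t q tpos qpos.
exists N => n leN; rewrite mulnBr leq_subLR.
rewrite mulnC -leq_divRL //; apply/bigmax_leqP => k /asboolP[C [psi [<- noV]]].
rewrite leq_divRL // mulnC leqNgt; apply/negP=> /ltnW lt; apply: noV.
exact: hN lt.
Qed.

Local Open Scope classical_set_scope.
Local Open Scope ring_scope.

Theorem theorem3p4 (R : realType) (r t : nat) (hr : (2 <= r)%N) (ht : (2 <= t)%N) :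
  exists h : nat -> R,
    h =o_\oo (fun n : nat => n%:R ^+ 2 : R) /\
    forall (n : nat) (C : eqType) (psi : {set 'I_n} -> C),
      (turan_number n (complete_graph 'I_r))%:R + h n < (num_colors psi)%:R ->
      exists V : 'I_r -> {set 'I_n},
        [/\ partite_classes t V,
            rainbow psi (edges_across V),
            forall i, [\/ monochromatic psi (edges_within (V i)),
                          rainbow psi (edges_within (V i))
                        | lex_colored psi (V i)]
          & forall i e f, e \in edges_within (V i) -> f \in edges_across V ->
              psi e <> psi f].
Proof.
exists (fun n => (color_excess r t n)%:R); split; last first.
  move=> n C psi; rewrite -natrD ltr_nat => lt; apply: contrapT => noV.
  have : (num_colors psi <= turan_number n (complete_graph 'I_r) + color_excess r t n)%N.
    by apply: unstructured_le_excess; exists C, psi.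
  by rewrite leqNgt lt.
apply/eqoP => eps eps0.
(* Any natural number q >= 1 / eps will do. *)
pose q := (Num.truncn eps^-1).+1.
have [N hN] := color_excess_small r t q (ltnW ht) isT.
near=> n.
have leN : (N <= n)%N by near: n; exact: nbhs_infty_ge.
rewrite !ger0_norm ?exprn_ge0 ?ler0n //.
rewrite -ler_pdivrMl // -natrX.
apply: le_trans (_ : (q * color_excess r t n)%:R <= _); last by rewrite ler_nat hN.
rewrite natrM ler_wpM2r ?ler0n //.
by rewrite ltW // truncnS_gt.
Unshelve. all: by end_near.
Qed.
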